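(* Let $\ell\ge 1$ be an integer. Then (i) for $p=2\ell$, $h_{2\ell,2}=2^{2\ell-1}-\frac12\binom{2\ell}{\ell}$; (ii) for $p=2\ell+1$, $h_{2\ell+1,2}=2^{2\ell}-\binom{2\ell}{\ell}$.
   Context: For integers $1\le r\le p$, $h_{p,r}$ denotes the maximal number of (distinct) binary words of length $p$ such that every two words of the set match (have equal entries) in at least $r$ spots. *)

(* Defs.v *)
From mathcomp Require Import all_boot all_order all_algebra.

Set Implicit Arguments.
Unset Strict Implicit.
Unset Printing Implicit Defensive.

Definition matches (p : nat) (u v : p.-tuple bool) : nat :=
  #|[set i : 'I_p | tnth u i == tnth v i]|.

Definition matching_family (p r : nat) (A : {set p.-tuple bool}) : bool :=
  [forall u in A, forall v in A, (u != v) ==> (r <= matches u v)].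

(* The empty family is always admissible, so this maximum is attained. The
   intended range is 1 <= r <= p. *)
Definition h (p r : nat) : nat :=
  \max_(A : {set p.-tuple bool} | matching_family r A) #|A|.

(* Main.v *)
Require Import Defs.
From mathcomp Require Import all_boot all_order all_algebra.
From mathcomp Require Import zify ring.

Set Implicit Arguments.
Unset Strict Implicit.
Unset Printing Implicit Defensive.

Import Order.TTheory GRing.Theory Num.Theory.
Local Open Scope ring_scope.

(** Upper bound for odd length [n = 2l+1]: a matching family [A] is independent
    in the Cayley graph on binary words joining two words that agree in exactly
    one spot.  The Walsh character [chi S] is an eigenvector of this graph, with
    eigenvalue [(-1)^|S| (n - 2|S|)], which never vanishes.  The quadratic form
    of the graph is zero on functions supported on [A], so the Fourier
    coefficients of such a function at the eigenvalues of one given sign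
    determine it; hence [#|A|] is at most the number of eigenvalues of the rarer
    sign, which is [2^(2l) - 'C(2l, l)].

    Lower bound for even length [2l]: take the words with fewer than [l] ones.
    Since
    prepending a free bit gives [2 * h p 2 <= h p.+1 2], these two bounds
    determine both values. *)

(** * Binomial sums and a dimension count *)

Lemma sum_card_set (n : nat) (F : nat -> nat) :
  (\sum_(S : {set 'I_n}) F #|S| = \sum_(j < n.+1) 'C(n, j) * F j)%N.
Proof.
have cardS (S : {set 'I_n}) : (#|S| < n.+1)%N.
  by rewrite ltnS -[X in (_ <= X)%N]card_ord max_card.
rewrite (partition_big (fun S => Ordinal (cardS S)) xpredT) //=.
apply: eq_bigr => j _.
rewrite (eq_bigr (fun _ => F j)); last by move=> S /eqP <-.
rewrite sum_nat_const; congr (_ * _)%N.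
by rewrite -[X in 'C(X, _)]card_ord -card_draws; apply: eq_card => S; rewrite !inE.
Qed.

Lemma card_set_ord (n : nat) : #|{: {set 'I_n}}| = (2 ^ n)%N.
Proof. by rewrite -cardsT -powersetT card_powerset cardsT card_ord. Qed.

Lemma sum_bin_pow2 (n : nat) : (\sum_(j < n.+1) 'C(n, j) = 2 ^ n)%N.
Proof.
have := sum_card_set n (fun=> 1%N).
rewrite sum1_card card_set_ord => ->.
by apply: eq_bigr => j _; rewrite muln1.
Qed.

Lemma sum_binS (n : nat) (F : nat -> nat) :
  (\sum_(j < n.+2) 'C(n.+1, j) * F j =
   \sum_(i < n.+1) 'C(n, i) * (F i + F i.+1))%N.
Proof.
rewrite big_ord_recl /= bin0 mul1n.
under eq_bigr => i _ do rewrite /bump /= add1n binS mulnDl.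
under [in RHS]eq_bigr => i _ do rewrite mulnDr.
rewrite !big_split /= addnA; congr (_ + _)%N.
rewrite big_ord_recr /= bin_small // mul0n addn0.
by rewrite [in RHS]big_ord_recl /= bin0 mul1n.
Qed.

(** Dimension count: the conditions indexed by [B] form a matrix with [#|A|] rows and rank at most
    [#|B|], so its left kernel contains a nonzero row, extended by zero outside [A]. *)
Lemma exists_supported_annihilated (T U : finType) (A : {set T}) (B : {set U})
    (K : T -> U -> rat) :
  (#|B| < #|A|)%N ->
  exists f : T -> rat, [/\ exists u, f u != 0, forall u, u \notin A -> f u = 0 &
    forall s, s \in B -> \sum_u f u * K u s = 0].
Proof.
move=> ltBA.
pose M := \matrix_(i < #|A|, j < #|B|) K (enum_val i) (enum_val j).
have : kermx M != 0.
  rewrite -mxrank_eq0 mxrank_ker subn_eq0 -ltnNge.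
  exact: leq_ltn_trans (rank_leq_col M) ltBA.
case/rowV0Pn=> v /sub_kermxP vM0 v_neq0.
pose f u := \sum_i v 0 i * (enum_val i == u)%:R.
have fE i : f (enum_val i) = v 0 i.
  rewrite /f (bigD1 i) //= eqxx mulr1 big1 ?addr0 // => k ki.
  by rewrite (inj_eq enum_val_inj) (negPf ki) mulr0.
exists f; split.
- case/matrix0Pn: v_neq0 => i [j]; rewrite (ord1 i) => vj.
  by exists (enum_val j); rewrite fE.
- move=> u uA; rewrite /f big1 // => i _; case: eqP => [ui|_]; last by rewrite mulr0.
  by case/negP: uA; rewrite -ui enum_valP.
move=> s sB; have := congr1 (fun N : 'rV__ => N 0 (enum_rank_in sB s)) vM0.
rewrite !mxE; apply: etrans.
under eq_bigr => u _ do rewrite /f mulr_suml.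
rewrite exchange_big; apply: eq_bigr => i _ /=.
rewrite (bigD1 (enum_val i)) //= eqxx mulr1 big1 ?addr0.
  by rewrite mxE enum_rankK_in.
by move=> u; rewrite eq_sym => /negPf ->; rewrite mulr0 mul0r.
Qed.

(** * Walsh characters and the quadratic form of the graph *)

Section Walsh.

Variable n : nat.
Implicit Types (S : {set 'I_n}) (u v : n.-tuple bool).

Definition chi S u : rat := \prod_(i in S) (-1) ^+ tnth u i.

Lemma chi_orthogonal u v :
  \sum_S chi S u * chi S v = if u == v then 2 ^+ n else 0.
Proof.
(* The sum over [S] factors over the positions: each factor is 2 where [u] and [v] agree and 0 where
   they differ. *)
transitivity (\prod_(i < n) ((-1) ^+ tnth u i * (-1) ^+ tnth v i + 1) : rat).
  rewrite bigA_distr; apply: eq_bigr => S _.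
  by rewrite /chi -big_split /= -big_mkcond.
case: eqP => [->|uv].
  rewrite -[n in RHS]card_ord -prodr_const; apply: eq_bigr => i _.
  by rewrite -signr_addb addbb.
apply/eqP; apply: contraT => /prodf_neq0 prod_neq0; case: uv.
apply: eq_from_tnth => i; have := prod_neq0 i isT.
by case: (tnth u i) (tnth v i) => [] [].
Qed.

Definition agree_only_at (i : 'I_n) v : n.-tuple bool :=
  [tuple if j == i then tnth v j else ~~ tnth v j | j < n].

Lemma matches_agree_only_at i v : matches (agree_only_at i v) v = 1%N.
Proof.
rewrite /matches -(cards1 i); congr #|pred_of_set _|; apply/setP=> j.
by rewrite !inE tnth_mktuple; case: (j == i); case: (tnth v j).
Qed.

Lemma matchesuu u : matches u u = n.
Proof.
rewrite /matches -[RHS]card_ord -cardsT; congr #|pred_of_set _|.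
by apply/setP=> j; rewrite !inE eqxx.
Qed.

(** Flipping every bit contributes one sign per element of [S]; leaving bit [i] unflipped takes one
    sign back when [i] is in [S]. *)
Lemma chi_agree_only_at S i v :
  chi S (agree_only_at i v) =
  (-1) ^+ #|S| * chi S v * (if i \in S then -1 else 1).
Proof.
have -> : (if i \in S then -1 else 1) =
    \prod_(j in S) (if j == i then -1 else 1) :> rat.
  case: ifPn => iS.
    by rewrite (bigD1 i) //= eqxx big1 ?mulr1 // => j /andP[_ /negPf ->].
  rewrite big1 // => j jS; case: eqP => // ji.
  by case/negP: iS; rewrite -ji.
rewrite -prodr_const /chi -!big_split /=; apply: eq_bigr => j _.
rewrite tnth_mktuple; case: (j == i); case: (tnth v j) => /=; ring.
Qed.

Definition eigenval S : rat := (-1) ^+ #|S| * (n%:R - 2 * #|S|%:R).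

Lemma chi_eigen S v : \sum_i chi S (agree_only_at i v) = eigenval S * chi S v.
Proof.
under eq_bigr do rewrite chi_agree_only_at.
rewrite -mulr_sumr.
have -> : \sum_(i < n) (if i \in S then -1 else 1) = n%:R - 2 * #|S|%:R :> rat.
  rewrite (eq_bigr (fun i => 1 - 2 * (i \in S)%:R)); last first.
    by move=> i _; case: (i \in S) => /=; ring.
  rewrite sumrB sumr_const card_ord -mulr_sumr; congr (_ - 2 * _).
  rewrite -natr_sum -sum1_card [in RHS]big_mkcond; congr _%:R.
by rewrite /eigenval; ring.
Qed.

Section IndependentSupport.

Variable A : {set n.-tuple bool}.
Hypotheses (n_gt1 : (1 < n)%N) (matchA : matching_family 2 A).
Variable f : n.-tuple bool -> rat.
Hypothesis supp_f : forall u, u \notin A -> f u = 0.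

Let fhat S := \sum_u f u * chi S u.

(** By orthogonality only pairs with [u = agree_only_at i v] survive, and two such words cannot both
    lie in [A]. *)
Lemma quadratic_form_eq0 : \sum_S eigenval S * fhat S ^+ 2 = 0.
Proof.
transitivity (\sum_u \sum_v \sum_i f u * f v *
                \sum_S chi S u * chi S (agree_only_at i v)).
  have termE S : eigenval S * fhat S ^+ 2 =
      \sum_u \sum_v \sum_i f u * f v * (chi S u * chi S (agree_only_at i v)).
    rewrite expr2 [fhat S * _]mulr_suml mulr_sumr; apply: eq_bigr => u _.
    rewrite mulrA mulr_sumr; apply: eq_bigr => v _.
    transitivity (f u * f v * chi S u * (eigenval S * chi S v)); first by ring.
    by rewrite -chi_eigen mulr_sumr; apply: eq_bigr => i _; rewrite mulrA.
  rewrite (eq_bigr _ (fun S _ => termE S)) exchange_big; apply: eq_bigr => u _.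
  rewrite exchange_big; apply: eq_bigr => v _.
  by rewrite exchange_big; apply: eq_bigr => i _; rewrite mulr_sumr.
rewrite big1 // => u _; rewrite big1 // => v _; rewrite big1 // => i _.
rewrite chi_orthogonal; case: eqP => [uE|_]; last by rewrite mulr0.
have [uA|/supp_f ->] := boolP (u \in A); last by rewrite !mul0r.
have [vA|/supp_f ->] := boolP (v \in A); last by rewrite mulr0 mul0r.
have uv1 : matches u v = 1%N by rewrite uE matches_agree_only_at.
have /implyP := forall_inP (forall_inP matchA u uA) v vA.
(* The family condition only concerns distinct words; equal ones would match in [n > 1] spots, not
   in one. *)
rewrite uv1 => uv; suff /uv : u != v by [].
by apply/eqP=> eq_uv; move: uv1 n_gt1; rewrite eq_uv matchesuu => ->.
Qed.

(** Fourier inversion recovers [2 ^+ n * f u] from the coefficients. *)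
Lemma fhat_eq0_fun_eq0 : (forall S, fhat S = 0) -> forall u, f u = 0.
Proof.
move=> fhat0 u.
have : \sum_S fhat S * chi S u = 2 ^+ n * f u.
  under eq_bigr => S _ do rewrite mulr_suml.
  have inner v : \sum_S f v * chi S v * chi S u = f v * (if v == u then 2 ^+ n else 0).
    by rewrite -chi_orthogonal mulr_sumr; apply: eq_bigr => S _; rewrite mulrA.
  rewrite exchange_big (eq_bigr _ (fun v _ => inner v)) (bigD1 u) //= eqxx mulrC.
  by rewrite big1 ?addr0 // => v /negPf ->; rewrite mulr0.
rewrite big1 => [/esym /eqP|S _]; last by rewrite fhat0 mul0r.
by rewrite mulf_eq0 expf_eq0 /= andbF /= => /eqP.
Qed.

End IndependentSupport.
End Walsh.

(** * Eigenvalue signs and the upper bound *)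

(* The eigenvalue [(-1)^j (2l+1-2j)] has sign [(-1)^l] at both middle sizes
   [j = l] and [j = l+1]; these are the sizes at which it has the other sign. *)
Definition rare_sign (l j : nat) : bool := odd j == odd l (+) (j <= l)%N.

Lemma eigenval_common_sign l (S : {set 'I_(2 * l).+1}) :
  ~~ rare_sign l #|S| -> 0 < (-1) ^+ l * eigenval S.
Proof.
rewrite /rare_sign /eigenval mulrA -exprD -signr_odd oddD.
set j := #|S| => rareN.
have [le_jl|lt_lj] := leqP j l.
  have -> : odd l (+) odd j = false.
    by move: rareN; rewrite le_jl; case: (odd j); case: (odd l).
  rewrite expr0 mul1r subr_gt0 -natrM ltr_nat; lia.
have -> : odd l (+) odd j = true.
  by move: rareN; rewrite leqNgt lt_lj; case: (odd j); case: (odd l).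
rewrite expr1 mulN1r oppr_gt0 subr_lt0 -natrM ltr_nat; lia.
Qed.

(** By Pascal's rule each ['C(2 * l, i)] is counted once for size [i] and once for size [i.+1].
    Exactly one of these sizes is rare, except for [i = l], where neither is. *)
Lemma card_rare_sign l :
  (#|[set S : {set 'I_(2 * l).+1} | rare_sign l #|S|]| + 'C(2 * l, l) =
   2 ^ (2 * l))%N.
Proof.
rewrite cardsE -sum1_card big_mkcond /=.
pose F j := (if rare_sign l j then 1 else 0)%N.
rewrite -[LHS]/(\sum_(S : {set 'I_(2 * l).+1}) F #|S| + 'C(2 * l, l))%N.
rewrite sum_card_set sum_binS.
rewrite -sum_bin_pow2.
have lt_l : (l < (2 * l).+1)%N by lia.
rewrite (bigD1 (Ordinal lt_l)) //= [RHS](bigD1 (Ordinal lt_l)) //=.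
have -> : (F l + F l.+1 = 0)%N.
  by rewrite /F /rare_sign leqnn ltnn /=; case: (odd l).
rewrite muln0 add0n addnC; congr (_ + _)%N; apply: eq_bigr => i il.
suff -> : (F i + F i.+1 = 1)%N by rewrite muln1.
rewrite /F /rare_sign /=; have {il} : nat_of_ord i != l by [].
by case: ltngtP => //; case: (odd i); case: (odd l).
Qed.

Lemma h_odd_le l : (1 <= l)%N ->
  (h (2 * l).+1 2 + 'C(2 * l, l) <= 2 ^ (2 * l))%N.
Proof.
move=> l_gt0; rewrite -card_rare_sign leq_add2r.
apply/bigmax_leqP => A matchA; rewrite leqNgt; apply/negP => ltBA.
case: (exists_supported_annihilated (fun u S => chi S u) ltBA).
move=> f [[u fu] supp_f f_ann]; case/negP: fu; apply/eqP.
have n_gt1 : (1 < (2 * l).+1)%N by lia.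
apply: fhat_eq0_fun_eq0 => S.
(* [f] kills the coefficients of rare sign, and the factor [(-1) ^+ l] makes the other eigenvalues
   positive. A vanishing sum of nonnegative terms then kills every remaining coefficient. *)
have terms_ge0 S' : 0 <= (-1) ^+ l * (eigenval S' * (\sum_u f u * chi S' u) ^+ 2).
  have [rare|rareN] := boolP (rare_sign l #|S'|).
    by rewrite f_ann ?inE // expr0n /= !mulr0.
  by rewrite mulrA mulr_ge0 ?sqr_ge0 // ltW // eigenval_common_sign.
have [rare|rareN] := boolP (rare_sign l #|S|); first by rewrite f_ann ?inE.
have /eqP := quadratic_form_eq0 n_gt1 matchA supp_f.
rewrite -(inj_eq (mulfI (x := (-1) ^+ l) _)) ?signr_eq0 // mulr0 mulr_sumr.
rewrite psumr_eq0 // => /allP /(_ S); rewrite mem_index_enum => /(_ isT).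
rewrite mulrA mulf_eq0 (gt_eqF (eigenval_common_sign rareN)) /=.
by rewrite expf_eq0 /= => /eqP.
Qed.

(** * Lower bounds by explicit families *)

Lemma matchesE p (u v : p.-tuple bool) :
  matches u v = (\sum_(i < p) (tnth u i == tnth v i))%N.
Proof. by rewrite /matches cardsE -sum1_card big_mkcond. Qed.

Lemma matches_cons p (b c : bool) (u v : p.-tuple bool) :
  matches [tuple of b :: u] [tuple of c :: v] = ((b == c) + matches u v)%N.
Proof.
rewrite !matchesE big_ord_recl !tnth0; congr (_ + _)%N.
by apply: eq_bigr => i _; rewrite !tnthS.
Qed.

Lemma double_h_le p r : (r <= p)%N -> (2 * h p r <= h p.+1 r)%N.
Proof.
move=> le_rp.
have family0 : matching_family r (set0 : {set p.-tuple bool}).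
  by apply/forall_inP => u; rewrite inE.
rewrite {1}/h (bigop.bigmax_eq_arg _ family0); case: arg_maxnP => // A matchA _.
pose ext (w : bool * p.-tuple bool) := [tuple of w.1 :: w.2].
have ext_inj : injective ext.
  by move=> [b u] [c v] /(congr1 val) /= [-> /val_inj ->].
have -> : (2 * #|A|)%N = #|ext @: setX [set: bool] A|.
  by rewrite card_imset // cardsX cardsT card_bool.
apply: leq_bigmax_cond.
apply/forall_inP => _ /imsetP[[b u] /setXP[_ uA] ->].
apply/forall_inP => _ /imsetP[[c v] /setXP[_ vA] ->].
apply/implyP => _; rewrite matches_cons.
(* Two extensions of the same word may differ in the new bit but still match in [p >= r] spots. *)
have [->|uv] := eqVneq u v; first by rewrite matchesuu; lia.
have /implyP /(_ uv) := forall_inP (forall_inP matchA u uA) v vA.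
by move/leq_trans; apply; rewrite leq_addl.
Qed.

Lemma h_even_ge l : (1 <= l)%N ->
  (2 ^ (2 * l) <= 2 * h (2 * l) 2 + 'C(2 * l, l))%N.
Proof.
move=> l_gt0; set n := (2 * l)%N.
pose ones (u : n.-tuple bool) := [set i | tnth u i].
pose word (S : {set 'I_n}) := [tuple i \in S | i < n].
have wordK : cancel word ones by move=> S; apply/setP=> i; rewrite inE tnth_mktuple.
have onesK : cancel ones word.
  by move=> u; apply: eq_from_tnth => i; rewrite tnth_mktuple inE.
pose A := [set u | (#|ones u| < l)%N].
have matchA : matching_family 2 A.
  apply/forall_inP => u; rewrite inE => uA; apply/forall_inP => v.
  rewrite inE => vA; apply/implyP => _.
  (* Where two words differ, one of them has a one; hence at most [2 * (l - 1)] disagreements,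
     leaving at least 2 matches. *)
  have disagree : (#|~: [set i | tnth u i == tnth v i]| <= #|ones u| + #|ones v|)%N.
    apply: leq_trans (leq_subr #|ones u :&: ones v| _).
    rewrite -cardsU subset_leq_card //; apply/subsetP=> i.
    by rewrite !inE; case: (tnth u i); case: (tnth v i).
  have := cardsC [set i | tnth u i == tnth v i].
  rewrite card_ord /matches; move: uA vA disagree.
  by move: #|_| #|_| #|_| #|_| => a b c d; rewrite /n; lia.
have cardA : #|A| = (\sum_(S : {set 'I_n}) (#|S| < l))%N.
  rewrite -sum1dep_card big_mkcond (reindex word) /=.
    by apply: eq_bigr => S _; rewrite wordK; case: ifP.
  by exists ones => ? _; [apply: wordK | apply: onesK].
(* Complementation exchanges the sets with fewer than [l] elements and those with more than [l]. *)
have cardA' : #|A| = (\sum_(S : {set 'I_n}) (l < #|S|))%N.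
  rewrite cardA (reindex_inj (inv_inj (@setCK _))) /=; apply: eq_bigr => S _.
  congr (nat_of_bool _); have := cardsC S; rewrite card_ord.
  by move: #|_| #|_| => a b; rewrite /n; lia.
have cardM : 'C(n, l) = (\sum_(S : {set 'I_n}) (#|S| == l))%N.
  rewrite -[n in LHS]card_ord -card_draws -sum1dep_card big_mkcond /=.
  by apply: eq_bigr => S _; case: eqP.
have -> : (2 ^ n = 2 * #|A| + 'C(n, l))%N.
  rewrite mul2n -addnn {1}cardA cardA' cardM -!big_split /=.
  rewrite -card_set_ord -sum1_card.
  by apply: eq_bigr => S _; case: ltngtP.
by rewrite leq_add2r leq_mul2l; apply: leq_bigmax_cond.
Qed.

Theorem theorem6p3 (l : nat) (hl : (1 <= l)%N) :
  ((h (2 * l) 2)%:R = 2 ^+ (2 * l - 1) - 2^-1 * 'C(2 * l, l)%:R :> rat) /\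
  ((h (2 * l + 1) 2)%:R = 2 ^+ (2 * l) - 'C(2 * l, l)%:R :> rat).
Proof.
have odd_le := h_odd_le hl.
have even_ge := h_even_ge hl.
have le_2_2l : (2 <= 2 * l)%N by lia.
have double_le := double_h_le le_2_2l.
(* The chain [2 ^ (2 * l) <= 2 * h (2 * l) 2 + 'C(2 * l, l) <= h (2 * l).+1 2 + 'C(2 * l, l) <= 2 ^
   (2 * l)] collapses to equalities. *)
have hE : (2 * h (2 * l) 2 + 'C(2 * l, l) = 2 ^ (2 * l))%N by lia.
have hO : (h (2 * l).+1 2 + 'C(2 * l, l) = 2 ^ (2 * l))%N by lia.
split; last by rewrite addn1 -natrX -hO natrD addrK.
apply: (mulfI (x := 2)) => //; rewrite mulrBr -exprS mulVKf //.
have -> : (2 * l - 1).+1 = (2 * l)%N by lia.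
by rewrite -natrX -hE natrD natrM addrK.
Qed.
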